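(* Fix $\delta t>0$ and assume that the constrained integrator (A) or (B) defined in the context is locally well-defined, and let $\nu\to0$. Then both integrators (computed with or without the Fixman correcting forces $\nabla_qV_{\mathrm{fix},\nu}$) converge at order $O(\nu^2)$ towards the leapfrog/Verlet scheme for the exact dynamics $$p_{n+1/2}=p_n-\tfrac{\delta t}2\nabla_qV(q_n),\quad q_{n+1}=q_n+\delta t\,M^{-1}p_{n+1/2},\quad p_{n+1}=p_{n+1/2}-\tfrac{\delta t}2\nabla_qV(q_{n+1}),$$ in the sense that, starting from the same $(q_n,p_n)$, the values $(q_{n+1},p_{n+1})$ given by the constrained integrator differ from those given by the leapfrog/Verlet scheme by $O(\nu^2)$.
   Context: $M$ ($d\times d$), $M_z$ ($n\times n$) are symmetric positive definite, $\beta>0$, $V:\mathbb{R}^d\to\mathbb{R}$, $\xi:\mathbb{R}^d\to\mathbb{R}^n$ smooth; $(\nabla_q\xi)_{ji}=\partial\xi_i/\partial q_j$. $M_\nu(q)=M+\nu^2\nabla_q\xi M_z\nabla_q^T\xi$ and $V_{\mathrm{fix},\nu}=\frac1{2\beta}\ln\det M_\nu$. Integrator (A): with Lagrange multipliers $\lambda_{n+1/2},\lambda_{n+1}\in\mathbb{R}^n$, $p_{n+1/2}=p_n-\frac{\delta t}2(\nabla_qV+\nabla_qV_{\mathrm{fix},\nu})(q_n)-\nabla_q\xi(q_n)\lambda_{n+1/2}$, $p^z_{n+1/2}=p^z_n+\frac1\nu\lambda_{n+1/2}$; $q_{n+1}=q_n+\delta t\,M^{-1}p_{n+1/2}$, $z_{n+1}=z_n+\delta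 t\,M_z^{-1}p^z_{n+1/2}$, with $\xi(q_{n+1})=z_{n+1}/\nu$; $p_{n+1}=p_{n+1/2}-\frac{\delta t}2(\nabla_qV+\nabla_qV_{\mathrm{fix},\nu})(q_{n+1})-\nabla_q\xi(q_{n+1})\lambda_{n+1}$, $p^z_{n+1}=p^z_{n+1/2}+\frac1\nu\lambda_{n+1}$, with $\nabla_q^T\xi(q_{n+1})M^{-1}p_{n+1}=\frac1\nu M_z^{-1}p^z_{n+1}$. Integrator (B), used when $V(q)=U(q,\xi(q))$ for a known smooth $U$: same as (A) except that in the $p$-updates $\nabla_qV(q)$ is replaced by $\nabla_1U(q,\xi(q))$ and the $p^z$-updates become $p^z_{n+1/2}=p^z_n-\frac{\delta t}{2\nu}\nabla_2U(q_n,\xi(q_n))+\frac1\nu\lambda_{n+1/2}$ and $p^z_{n+1}=p^z_{n+1/2}-\frac{\delta t}{2\nu}\nabla_2U(q_{n+1},\xi(q_{n+1}))+\frac1\nu\lambda_{n+1}$, where $\nabla_1,\nabla_2$ are gradients in the first and second variables of $U$. ''Without Fixman forces'' means the terms $\nabla_qV_{\mathrm{fix},\nu}$ are dropped. States satisfy $\xi(q_n)=z_n/\nu$ and $\nabla_q^T\xi(q_n)M^{-1}p_n=\frac1\nu M_z^{-1}p^z_n$, so $(z_n,p^z_n)$ is determined by $(q_n,p_n)$. ''Locally well-defined'' means the implicit equations for the constraints have a locally unique solution (in a neighborhood of the considered state). *)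

(* Defs.v *)
From HB Require Import structures.
From mathcomp Require Import all_boot all_order all_algebra.
From mathcomp Require Import all_classical all_reals all_analysis.
Set Implicit Arguments.
Unset Strict Implicit.
Unset Printing Implicit Defensive.
Import Order.TTheory GRing.Theory Num.Theory.
Import numFieldNormedType.Exports.
Local Open Scope classical_set_scope.
Local Open Scope ring_scope.

Definition sym_posdef (R : realType) (k : nat) (A : 'M[R]_k) : Prop :=
  A^T = A /\ forall u : 'cV[R]_k, u != 0 -> 0 < (u^T *m A *m u) 0 0.

(* For a finite-dimensional domain [E], all directional derivatives being of
   class C^k is the same as the Frechet derivative being of class C^k. *)
Fixpoint of_class_C (R : realType) (E F : normedModType R) (k : nat)
    (f : E -> F) : Prop :=
  if k is k'.+1 then
    (forall x : E, differentiable f x) /\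
    (forall v : E, of_class_C k' (fun x : E => 'D_v f x))
  else continuous f.

Definition smooth (R : realType) (E F : normedModType R) (f : E -> F) : Prop :=
  forall k : nat, of_class_C k f.

Definition grad (R : realType) (k : nat) (f : 'cV[R]_k -> R) (x : 'cV[R]_k) :
    'cV[R]_k :=
  \col_j 'D_(delta_mx j 0) f x.

(* The transposed Jacobian: the i-th column is the gradient of the i-th
   component of [xi]. *)
Definition nabla (R : realType) (d n : nat) (xi : 'cV[R]_d -> 'cV[R]_n)
    (q : 'cV[R]_d) : 'M[R]_(d, n) :=
  \matrix_(j < d, i < n) 'D_(delta_mx j 0) (fun x => xi x i 0) q.

Section Integrators.
Variables (R : realType) (d n : nat).
Variables (M : 'M[R]_d) (Mz : 'M[R]_n) (xi : 'cV[R]_d -> 'cV[R]_n).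
Variables (beta dt : R).

Definition M_nu (nu : R) (q : 'cV[R]_d) : 'M[R]_d :=
  M + nu ^+ 2 *: (nabla xi q *m Mz *m (nabla xi q)^T).

Definition V_fix (nu : R) (q : 'cV[R]_d) : R :=
  (2 * beta)^-1 * ln (\det (M_nu nu q)).

Record state := State {
  pos : 'cV[R]_d;    (* q *)
  auxpos : 'cV[R]_n; (* z *)
  mom : 'cV[R]_d;    (* p *)
  auxmom : 'cV[R]_n  (* p^z *)
}.

Definition on_constraint (nu : R) (s : state) : Prop :=
  xi (pos s) = nu^-1 *: auxpos s /\
  (nabla xi (pos s))^T *m invmx M *m mom s = nu^-1 *: (invmx Mz *m auxmom s).

(* The common shape of the two integrators: [gp q] and [gz q] are the gradients
   entering the p-update and the p^z-update, and [l = (l.1, l.2)] are the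
   multipliers of the first and of the second half step.  Integrator (A) has
   [gz = 0]. *)
Definition constrained_step (gp : 'cV[R]_d -> 'cV[R]_d)
    (gz : 'cV[R]_d -> 'cV[R]_n) (nu : R)
    (s : state) (l : 'cV[R]_n * 'cV[R]_n) (s' : state) : Prop :=
  let ph := mom s - (dt / 2) *: gp (pos s) - nabla xi (pos s) *m l.1 in
  let pzh := auxmom s - (dt / 2) *: gz (pos s) + nu^-1 *: l.1 in
  pos s' = pos s + dt *: (invmx M *m ph) /\
  auxpos s' = auxpos s + dt *: (invmx Mz *m pzh) /\
  mom s' = ph - (dt / 2) *: gp (pos s') - nabla xi (pos s') *m l.2 /\
  auxmom s' = pzh - (dt / 2) *: gz (pos s') + nu^-1 *: l.2 /\
  on_constraint nu s'.

Definition fixman_force (fixman : bool) (nu : R) (q : 'cV[R]_d) : 'cV[R]_d :=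
  if fixman then grad (V_fix nu) q else 0.

Definition integrator := R -> state -> 'cV[R]_n * 'cV[R]_n -> state -> Prop.

Definition integratorA (fixman : bool) (V : 'cV[R]_d -> R) : integrator :=
  fun nu =>
    constrained_step (fun q => grad V q + fixman_force fixman nu q)
                     (fun=> 0) nu.

Definition integratorB (fixman : bool) (U : 'cV[R]_d -> 'cV[R]_n -> R) :
    integrator :=
  fun nu =>
    constrained_step
      (fun q => grad (fun x => U x (xi q)) q + fixman_force fixman nu q)
      (fun q => nu^-1 *: grad (U q) (xi q)) nu.

Definition initial_state (nu : R) (q p : 'cV[R]_d) (s : state) : Prop :=
  pos s = q /\ mom s = p /\ on_constraint nu s.

(* Starting from (q, p), the implicit equations have one and only one solution
   whose (q, p)-part lies in [N], a set which does not depend on [nu].  On the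
   constraint manifold (q, p) determines the full state. *)
Definition locally_well_defined (Phi : integrator) (q p : 'cV[R]_d)
    (N : set ('cV[R]_d * 'cV[R]_d)) : Prop :=
  \forall nu \near 0^'+, forall s : state, initial_state nu q p s ->
    exists! x : ('cV[R]_n * 'cV[R]_n) * state,
      Phi nu s x.1 x.2 /\ N (pos x.2, mom x.2).

Definition verlet (V : 'cV[R]_d -> R) (q p : 'cV[R]_d) :
    'cV[R]_d * 'cV[R]_d :=
  let ph := p - (dt / 2) *: grad V q in
  let q' := q + dt *: (invmx M *m ph) in
  (q', ph - (dt / 2) *: grad V q').

(* [N] has to be bounded uniformly in [nu]: when [xi] grows superlinearly the
   implicit equations may have further isolated roots escaping to infinity
   as [nu] tends to 0. *)
Definition converges_to_verlet_O2 (V : 'cV[R]_d -> R) (Phi : integrator) :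
    Prop :=
  forall (q p : 'cV[R]_d) (N : set ('cV[R]_d * 'cV[R]_d)),
    nbhs (q, p) N -> bounded_set N -> locally_well_defined Phi q p N ->
    exists C : R, \forall nu \near 0^'+,
      forall (s : state) (l : 'cV[R]_n * 'cV[R]_n) (s' : state),
        initial_state nu q p s -> Phi nu s l s' -> N (pos s', mom s') ->
        `|pos s' - (verlet V q p).1| <= C * nu ^+ 2 /\
        `|mom s' - (verlet V q p).2| <= C * nu ^+ 2.

End Integrators.

(* Main.v *)
(** Both constraints express the auxiliary momenta through (q, p), so the
    multipliers can be solved for: they equal (dt/2) nu gz(q) + O(nu^2), where
    nu gz vanishes for (A) and is the second partial gradient of U for (B).
    In the p-update the leading part is exactly what the chain rule needs to
    rebuild the full force - grad V.  The Fixman force is O(nu^2) because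
    det (M + t G(q)) = det M + t h(t, q) with h and its q-derivatives bounded
    on balls.  As the new state stays in the bounded set N, all the constants
    are uniform, and grad V is Lipschitz there. *)
Require Import Defs.
From HB Require Import structures.
From mathcomp Require Import all_boot all_order all_algebra.
From mathcomp Require Import all_classical all_reals all_analysis.
From mathcomp Require Import ring lra.
Import Order.TTheory GRing.Theory Num.Theory.
Import numFieldNormedType.Exports.
Local Open Scope classical_set_scope.
Local Open Scope ring_scope.

(** * Max norm of matrices and uniform bounds on balls *)

Lemma mx_norm_leP {R : realDomainType} {m n : nat} (A : 'M[R]_(m, n)) (C : R) :
  0 <= C -> (`|A| <= C) <-> (forall i j, `|A i j| <= C).
Proof.
move=> C0; rewrite /Num.Def.normr/= mx_normrE; split.
  move=> + i j; apply: le_trans.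
  exact: (le_bigmax _ (fun ij : 'I_m * 'I_n => `|A ij.1 ij.2|) (i, j)).
by move=> hA; apply: bigmax_le => // -[i j] _; exact: hA.
Qed.

Lemma normr_mxE_le {R : realDomainType} {m n : nat} (A : 'M[R]_(m, n)) i j :
  `|A i j| <= `|A|.
Proof. exact: (mx_norm_leP A _ (normr_ge0 A)).1 (lexx _) i j. Qed.

Lemma normr_mulmx_le {R : realDomainType} {m n p : nat} (A : 'M[R]_(m, n))
    (B : 'M[R]_(n, p)) :
  `|A *m B| <= n%:R * `|A| * `|B|.
Proof.
apply/mx_norm_leP; first by rewrite !mulr_ge0.
move=> i j; rewrite mxE (le_trans (ler_norm_sum _ _ _))//.
apply: (@le_trans _ _ (\sum_(k < n) (`|A| * `|B|))).
  by apply: ler_sum => k _; rewrite normrM ler_pM ?normr_mxE_le.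
by rewrite sumr_const card_ord -[leLHS]mulr_natl mulrA.
Qed.

Lemma normr_trmx {R : realDomainType} {m n : nat} (A : 'M[R]_(m, n)) :
  `|A^T| = `|A|.
Proof.
apply/eqP; rewrite eq_le; apply/andP; split; apply/mx_norm_leP => // i j.
  by rewrite mxE normr_mxE_le.
by rewrite -[A]trmxK mxE trmxK normr_mxE_le.
Qed.

(** The sum of the absolute values of the individual bounds serves all indices at once; it is
    nonnegative even for an empty index type. *)
Lemma uniform_bound {R : realDomainType} {I : finType} {T : Type}
    (P : T -> Prop) (F : I -> T -> R) :
  (forall i, exists C, forall x, P x -> F i x <= C) ->
  exists2 C, 0 <= C & forall i x, P x -> F i x <= C.
Proof.
move=> /choice[c cP]; exists (\sum_i `|c i|); first exact: sumr_ge0.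
move=> i x /cP/le_trans; apply; rewrite (bigD1 i)//= (le_trans (ler_norm _))//.
by rewrite lerDl sumr_ge0.
Qed.

Lemma trmx_continuous {R : realType} {m n : nat} :
  continuous (@trmx R m n).
Proof.
move=> A U /= /nbhs_ballP[e e0 eU]; apply/nbhs_ballP; exists e => //= B AB.
by apply: eU; move: AB; rewrite -!ball_normE /= -raddfB/= normr_trmx.
Qed.

(** Compactness of the closed ball, taken among row vectors; transposition is an isometry and
    carries the bound over to columns. *)
Lemma continuous_bounded_ball {R : realType} {k : nat} (f : 'cV[R]_k -> R)
    (r : R) :
  continuous f -> exists C, forall x, `|x| <= r -> `|f x| <= C.
Proof.
move=> cf; pose A := [set u : 'rV[R]_k | `|u| <= r].
have cA : compact A.
  apply: bounded_closed_compact.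
    exists r; split; [exact: num_real|move=> x rx u /= ur].
    exact: le_trans ur (ltW rx).
  rewrite (_ : A = (fun u => `|u|) @^-1` [set y | y <= r])//.
  by apply: preimage_closed => [u _|]; [exact: norm_continuous|exact: closed_le].
have cg : continuous (f \o trmx).
  by move=> u; apply: continuous_comp; [exact: trmx_continuous|exact: cf].
have /compact_bounded[C [_ hC]] :=
  continuous_compact (continuous_subspaceT cg : {within A, continuous _}) cA.
exists (C + 1) => x xr; apply: hC; first by rewrite ltrDl.
by exists x^T; rewrite /A/= ?trmxK ?normr_trmx.
Qed.

(** * Smooth functions: coordinates, partial derivatives, local Lipschitz bounds *)

Section Smooth.
Context {R : realType} {E F : normedModType R} {f : E -> F}.
Hypothesis f_smooth : smooth f.

Lemma smooth_continuous : continuous f.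
Proof. exact: f_smooth 0%N. Qed.

Lemma smooth_differentiable x : differentiable f x.
Proof. exact: (f_smooth 1%N).1. Qed.

Lemma smooth_derive v : smooth (fun x => 'D_v f x).
Proof. by move=> k; exact: (f_smooth k.+1).2. Qed.

End Smooth.

(** Taking an entry is linear and continuous, so it commutes with directional derivatives; the
    induction on the order therefore has to range over all [f]. *)
Lemma smooth_coord {R : realType} {E : normedModType R} {m n : nat}
    (f : E -> 'M[R]_(m, n)) i j :
  smooth f -> smooth (fun x => f x i j).
Proof.
move=> fs k; elim: k f fs => [|k IH] f fs /=.
  move=> x; apply: (@continuous_comp _ _ _ f (fun A : 'M[R]_(m, n) => A i j) x);
    first exact: (smooth_continuous fs).
  exact: coord_continuous.
split=> [x|v].
  apply: (@differentiable_comp _ _ _ _ f (fun A : 'M[R]_(m, n) => A i j) x);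
    first exact: (smooth_differentiable fs).
  exact: differentiable_coord.
rewrite (_ : (fun x => _) = (fun x => ('D_v f x) i j)); last first.
  apply/funext => x; rewrite derive_mx ?mxE//.
  exact/diff_derivable/smooth_differentiable.
exact/IH/smooth_derive.
Qed.

Lemma cV_sum_delta {R : pzSemiRingType} {k : nat} (v : 'cV[R]_k) :
  v = \sum_j v j 0 *: delta_mx j 0.
Proof.
by rewrite [LHS]matrix_sum_delta; apply: eq_bigr => i _; rewrite big_ord1.
Qed.

Lemma derive_sum_delta {R : realType} {k : nat} (f : 'cV[R]_k -> R) x v :
  differentiable f x ->
  'D_v f x = \sum_j v j 0 * 'D_(delta_mx j 0) f x.
Proof.
move=> df; rewrite deriveE// [X in 'd _ _ X]cV_sum_delta linear_sum.
by apply: eq_bigr => j _; rewrite linearZ deriveE.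
Qed.

(** Mean value theorem along the segment from [y] to [x], with all partial derivatives bounded on
    the ball. *)
Lemma smooth_lipschitz_ball {R : realType} {k : nat} (f : 'cV[R]_k -> R)
    (r : R) :
  smooth f -> exists L, forall x y, `|x| <= r -> `|y| <= r ->
    `|f x - f y| <= L * `|x - y|.
Proof.
move=> fs.
have [|C C0 hC] := @uniform_bound R 'I_k 'cV[R]_k (fun x => `|x| <= r)
    (fun j x => `|'D_(delta_mx j 0) f x|).
  by move=> j; apply/continuous_bounded_ball/smooth_continuous/smooth_derive.
(* [C] bounds each of the [k] partial derivatives on the ball. *)
exists (k%:R * C) => x y xr yr.
pose g (s : R) : 'cV[R]_k := y + s *: (x - y).
have dg (s : R) : is_derive s 1 (f \o g) ('D_(x - y) f (g s)).
  have dg : is_diff s g ( *:%R^~ (x - y)).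
    by apply: (is_diff_eq (is_diffD _ _)); rewrite add0r.
  have df := differentiableP (smooth_differentiable fs (g s)).
  have dfg := is_diff_comp dg df.
  apply: DeriveDef.
    by apply: diff_derivable; exact: ex_diff.
  rewrite deriveE; last exact: ex_diff.
  by rewrite diff_val /= scale1r -deriveE//; exact: smooth_differentiable.
have cfg : {within `[0, 1], continuous (f \o g)}.
  apply: continuous_subspaceT => s; apply: differentiable_continuous.
  by apply/derivable1_diffP; exact: ex_derive.
have [c] := @MVT R (f \o g) (fun s => 'D_(x - y) f (g s)) 0 1 ltr01
  (fun s _ => dg s) cfg.
rewrite in_itv /= => /andP[c0 c1]; rewrite /= /g scale1r scale0r addr0.
rewrite (addrC y) subrK subr0 mulr1 => ->; set z := y + c *: _.
(* The intermediate point is a convex combination of [x] and [y], so it stays in the ball. *)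
have zr : `|z| <= r.
  have -> : z = (1 - c) *: y + c *: x.
    by rewrite /z scalerBl scale1r scalerBr addrA addrAC.
  have c'0 : 0 <= 1 - c by rewrite subr_ge0 ltW.
  rewrite (le_trans (ler_normD _ _))// !normrZ (ger0_norm c'0) (gtr0_norm c0).
  have -> : r = (1 - c) * r + c * r by ring.
  by rewrite lerD// ler_wpM2l// ltW.
rewrite derive_sum_delta; last exact: smooth_differentiable.
rewrite (le_trans (ler_norm_sum _ _ _))//.
apply: (@le_trans _ _ (\sum_(j < k) (C * `|x - y|))).
  apply: ler_sum => j _; rewrite normrM mulrC.
  by rewrite ler_pM ?normr_mxE_le ?hC.
by rewrite sumr_const card_ord -[leLHS]mulr_natl mulrA.
Qed.

(** * Chain rule along the graph of the constraint map *)

Section PartialGradients.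
Context {R : realType} {d n : nat}.
Variables (U : 'cV[R]_d -> 'cV[R]_n -> R) (xi : 'cV[R]_d -> 'cV[R]_n).
Hypothesis U_smooth : smooth (fun x : 'cV[R]_d * 'cV[R]_n => U x.1 x.2).
Hypothesis xi_smooth : smooth xi.

(** The differential of [U] at (q, xi q) is linear, so its value at (v, d xi v) splits into the
    values at (v, 0) and (0, d xi v). For integrator (B) this recovers the gradient of [V] from the
    two partial gradients. *)
Lemma grad_comp_graph q :
  grad (fun x => U x (xi x)) q =
  grad (fun x => U x (xi q)) q + nabla xi q *m grad (U q) (xi q).
Proof.
pose W (x : 'cV[R]_d * 'cV[R]_n) := U x.1 x.2.
have dW x : differentiable W x := smooth_differentiable U_smooth x.
have dxi := smooth_differentiable xi_smooth q.
have E1 v : 'D_v (fun x => U x (xi x)) q = 'd W (q, xi q) (v, 'd xi q v).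
  have dp : is_diff q (fun x => (x, xi x)) (fun v => (v, 'd xi q v)).
    by apply: is_diff_pair; exact: differentiableP.
  have h := is_diff_comp dp (differentiableP (dW (q, xi q))).
  rewrite deriveE; last exact: (@ex_diff _ _ _ _ _ _ _ h).
  by rewrite (@diff_val _ _ _ _ _ _ _ h).
have E2 v : 'D_v (fun x => U x (xi q)) q = 'd W (q, xi q) (v, 0).
  have dp : is_diff q (fun x => (x, xi q)) (fun v => (v, 0)).
    by apply: is_diff_pair.
  have h := is_diff_comp dp (differentiableP (dW (q, xi q))).
  rewrite deriveE; last exact: (@ex_diff _ _ _ _ _ _ _ h).
  by rewrite (@diff_val _ _ _ _ _ _ _ h).
have E3 w : 'D_w (U q) (xi q) = 'd W (q, xi q) (0, w).
  have dp : is_diff (xi q) (fun y => (q, y)) (fun w => (0, w)).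
    by apply: is_diff_pair.
  have h := is_diff_comp dp (differentiableP (dW (q, xi q))).
  rewrite deriveE; last exact: (@ex_diff _ _ _ _ _ _ _ h).
  by rewrite (@diff_val _ _ _ _ _ _ _ h).
have dU : differentiable (U q) (xi q).
  have dp : is_diff (xi q) (fun y => (q, y)) (fun w => (0, w)).
    by apply: is_diff_pair.
  have h := is_diff_comp dp (differentiableP (dW (q, xi q))).
  exact: (@ex_diff _ _ _ _ _ _ _ h).
apply/colP => j; rewrite !mxE E1 E2.
have -> : (delta_mx j 0, 'd xi q (delta_mx j 0)) =
    (delta_mx j 0, 0) + (0, 'd xi q (delta_mx j 0)) :> 'cV[R]_d * 'cV[R]_n.
  by rewrite /GRing.add/= /add_pair /= addr0 add0r.
rewrite linearD; congr (_ + _).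
rewrite -E3 derive_sum_delta//; apply: eq_bigr => i _.
by rewrite !mxE -deriveE// derive_mx ?mxE//; exact: diff_derivable.
Qed.

End PartialGradients.

(** * Invertibility and determinant of positive definite matrices *)

Section SymPosdef.
Context {R : realType} {k : nat} {A : 'M[R]_k}.
Hypothesis A_spd : sym_posdef A.

(** A row u with u A^T = 0 satisfies u A u^T = 0 by symmetry, which definiteness forbids unless u =
    0. *)
Lemma sym_posdef_unitmx : A \in unitmx.
Proof.
rewrite -unitmx_tr -row_free_unit -kermx_eq0; apply/eqP/row_matrixP => i.
rewrite row0; set u := row i _.
have uA : u *m A^T = 0 by apply/sub_kermxP; rewrite row_sub.
apply/eqP/negPn/negP => u0.
have : u^T != 0 by apply: contra u0 => /eqP h; rewrite -[u]trmxK h trmx0.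
by move/A_spd.2; rewrite trmxK -{1}A_spd.1 uA mul0mx mxE ltxx.
Qed.

End SymPosdef.

Lemma sym_posdef_segment {R : realType} {k : nat} (A : 'M[R]_k) (s : R) :
  sym_posdef A -> 0 <= s <= 1 -> sym_posdef ((1 - s)%:M + s *: A).
Proof.
move=> [Asym Apos] /andP[s0 s1]; split.
  by rewrite linearD /= tr_scalar_mx linearZ /= Asym.
move=> u u0; rewrite mulmxDr mulmxDl mxE mul_mx_scalar -scalemxAl.
rewrite -scalemxAr -scalemxAl [X in _ + X]mxE [X in X + _]mxE.
have uu : 0 < (u^T *m u) 0 0.
  have [j uj] : exists j, u j 0 != 0.
    apply/existsP; apply: contraR u0; rewrite negb_exists => /forallP h.
    by apply/eqP/colP => j; rewrite mxE; apply/eqP/negPn/h.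
  rewrite mxE (bigD1 j)//= mxE ltr_pwDl//.
    by rewrite -expr2 exprn_even_gt0.
  by apply: sumr_ge0 => i _; rewrite mxE -expr2 sqr_ge0.
(* Strict positivity comes from the identity part when [s] is 0, and from [A] otherwise, since then
   1 - s may vanish. *)
have := Apos _ u0; move: uu; rewrite le_eqVlt in s0.
move: s0 => /predU1P[<-|s0] uu uAu.
  by rewrite subr0 mul1r mul0r addr0.
by rewrite ltr_wpDl ?mulr_gt0// mulr_ge0 ?subr_ge0// ltW.
Qed.

(* The determinant does not vanish on the segment from the identity to [A]. *)
Lemma sym_posdef_det_gt0 {R : realType} {k : nat} (A : 'M[R]_k) :
  sym_posdef A -> 0 < \det A.
Proof.
move=> A_spd; rewrite ltNge; apply/negP => detA.
(* The determinant along the segment, as a polynomial in the parameter, to which the intermediate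
   value theorem for polynomials applies. *)
pose p : {poly R} := \det ((1 - 'X)%:M + 'X *: map_mx polyC A).
have pE s : p.[s] = \det ((1 - s)%:M + s *: A).
  rewrite -[LHS]/(horner_eval s p) /p -det_map_mx; congr (\det _).
  apply/matrixP => i j; rewrite !mxE /= /horner_eval.
  by rewrite !(hornerE, hornerMn).
have p0 : (- p).[0] <= 0.
  by rewrite hornerN pE subr0 scale0r addr0 det1 oppr_le0 ler01.
have p1 : 0 <= (- p).[1].
  by rewrite hornerN pE subrr scale1r raddf0 add0r oppr_ge0.
(* The opposite polynomial goes from -1 to a nonnegative value; at its root a positive definite
   matrix would be singular. *)
have [|s s01] := @poly_ivt R (- p) 0 1 ler01; first by rewrite p0 p1.
rewrite rootN /root pE; apply/negP.
rewrite -unitfE -unitmxE; apply: sym_posdef_unitmx.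
exact: sym_posdef_segment.
Qed.

(** * First-order perturbations of a constant, up to determinant and logarithm *)

(** As [c] does not depend on the point, the derivative of [f t] along [v] is O(t) on the ball.
    Keeping the remainder [h] explicit makes the class stable under sums and products, hence under
    determinants. *)
Definition perturbation {R : realType} {E : normedModType R} (r : R) (v : E)
    (f : R -> E -> R) (c : R) : Prop :=
  exists (h : R -> E -> R) (B : R),
    [/\ forall t x, f t x = c + t * h t x,
        forall t x, differentiable (h t) x &
        forall t x, 0 <= t <= 1 -> `|x| <= r ->
          `|h t x| <= B /\ `|'D_v (h t) x| <= B].

Section Perturbation.
Context {R : realType} {E : normedModType R} {r : R} {v : E}.
Implicit Types (f g : R -> E -> R) (c : R).
Local Notation perturbation := (perturbation r v).

Lemma perturbation_cst c : perturbation (fun _ _ => c) c.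
Proof.
exists (fun _ _ => 0), 0; split => [t x|t x|t x _ _].
- by rewrite mulr0 addr0.
- exact: differentiable_cst.
- by rewrite derive_cst normr0.
Qed.

Lemma perturbationD f g a b : perturbation f a -> perturbation g b ->
  perturbation (fun t x => f t x + g t x) (a + b).
Proof.
move=> [h [B [fh dh hB]]] [k [C [gk dk kC]]].
exists (fun t x => h t x + k t x), (B + C); split => [t x|t x|t x t01 xr].
- by rewrite fh gk; ring.
- exact: differentiableD.
- have [hB1 hB2] := hB t x t01 xr; have [kC1 kC2] := kC t x t01 xr.
  have -> : 'D_v (fun x => h t x + k t x) x = 'D_v (h t) x + 'D_v (k t) x.
    by apply: deriveD; exact: diff_derivable.
  by split; rewrite (le_trans (ler_normD _ _))// lerD.
Qed.

(** (a + t h)(b + t k) = a b + t (a k + b h + t h k), and the inner factor t is at most 1 in the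
    bounds. *)
Lemma perturbationM f g a b : perturbation f a -> perturbation g b ->
  perturbation (fun t x => f t x * g t x) (a * b).
Proof.
move=> [h [B [fh dh hB]]] [k [C [gk dk kC]]].
exists (fun t x => a * k t x + b * h t x + t * (h t x * k t x)),
  (`|a| * C + `|b| * B + (B * C + C * B)).
have dhk t x : is_derive x v
    (fun x => a * k t x + b * h t x + t * (h t x * k t x))
    (a * 'D_v (k t) x + b * 'D_v (h t) x +
     t * (h t x * 'D_v (k t) x + k t x * 'D_v (h t) x)).
  have dh' : is_derive x v (h t) ('D_v (h t) x).
    exact/derivableP/diff_derivable.
  have dk' : is_derive x v (k t) ('D_v (k t) x).
    exact/derivableP/diff_derivable.
  exact: (is_deriveD (is_deriveD (is_deriveZ a dk') (is_deriveZ b dh'))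
    (is_deriveZ t (is_deriveM dh' dk'))).
split => [t x|t x|t x t01 xr].
- by rewrite fh gk; ring.
- apply: differentiableD; first apply: differentiableD.
  + exact: (differentiableZ _ (dk t x)).
  + exact: (differentiableZ _ (dh t x)).
  + exact: (differentiableZ _ (differentiableM (dh t x) (dk t x))).
- have [hB1 hB2] := hB t x t01 xr; have [kC1 kC2] := kC t x t01 xr.
  have B0 : 0 <= B := le_trans (normr_ge0 _) hB1.
  have C0 : 0 <= C := le_trans (normr_ge0 _) kC1.
  have nt (y D : R) : `|y| <= D -> `|t * y| <= D.
    move=> yD; rewrite normrM (le_trans _ yD)// ler_piMl//.
    by rewrite ger0_norm; case/andP: t01.
  rewrite (@derive_val _ _ _ _ _ _ _ (dhk t x)).
  split; rewrite (le_trans (ler_normD _ _))// lerD//.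
  + by rewrite (le_trans (ler_normD _ _))// lerD// normrM ler_wpM2l.
  + rewrite nt// normrM (@le_trans _ _ (B * C)) ?ler_pM// lerDl.
    by rewrite mulr_ge0.
  + by rewrite (le_trans (ler_normD _ _))// lerD// normrM ler_wpM2l.
  + by rewrite nt// (le_trans (ler_normD _ _))// lerD// normrM ler_pM.
Qed.

Lemma perturbation_sum (I : Type) (s : seq I) (f : I -> R -> E -> R)
    (c : I -> R) :
  (forall i, perturbation (f i) (c i)) ->
  perturbation (fun t x => \sum_(i <- s) f i t x) (\sum_(i <- s) c i).
Proof.
move=> fc; elim: s => [|i s IH].
  under eq_fun do under eq_fun do rewrite big_nil.
  by rewrite big_nil; exact: perturbation_cst.
under eq_fun do under eq_fun do rewrite big_cons.
by rewrite big_cons; exact: perturbationD.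
Qed.

Lemma perturbation_prod (I : Type) (s : seq I) (f : I -> R -> E -> R)
    (c : I -> R) :
  (forall i, perturbation (f i) (c i)) ->
  perturbation (fun t x => \prod_(i <- s) f i t x) (\prod_(i <- s) c i).
Proof.
move=> fc; elim: s => [|i s IH].
  under eq_fun do under eq_fun do rewrite big_nil.
  by rewrite big_nil; exact: perturbation_cst.
under eq_fun do under eq_fun do rewrite big_cons.
by rewrite big_cons; exact: perturbationM.
Qed.

(** Leibniz formula: a sum over permutations of a constant sign times a product of entries. *)
Lemma perturbation_det (k : nat) (F : R -> E -> 'M[R]_k) (A : 'M[R]_k) :
  (forall i j, perturbation (fun t x => F t x i j) (A i j)) ->
  perturbation (fun t x => \det (F t x)) (\det A).
Proof.
move=> FA; apply: perturbation_sum => s; apply: perturbationM.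
  exact: perturbation_cst.
by apply: perturbation_prod => i; exact: FA.
Qed.

(** For small t the function stays above c / 2 on the ball, so the logarithmic derivative t D_v h /
    f is at most (2 / c) B t in absolute value. *)
Lemma perturbation_ln f c : 0 < c -> perturbation f c ->
  exists C, \forall t \near 0^'+, forall x, `|x| <= r ->
    differentiable (fun x => ln (f t x)) x /\
    `|'D_v (fun x => ln (f t x)) x| <= C * t.
Proof.
move=> c0 [h [B [fh dh hB]]]; exists (2 / c * `|B|).
near=> t => x xr.
have t0 : 0 < t by near: t; exact: nbhs_right_gt.
have t1 : t <= 1 by near: t; apply: nbhs_right_le.
(* Adding 1 keeps the divisor in the threshold for [t] positive even if [B] is 0. *)
have tB : t * (`|B| + 1) <= c / 2.
  rewrite -ler_pdivlMr; last by rewrite ltr_wpDl.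
  by near: t; apply: nbhs_right_le; rewrite !divr_gt0// ltr_wpDl.
have [|hB1 hB2] := hB t x _ xr; first by rewrite ltW.
have fc : c / 2 <= f t x.
  have : `|t * h t x| <= c / 2.
    rewrite normrM gtr0_norm// (le_trans _ tB)// ler_wpM2l ?(ltW t0)//.
    by rewrite (le_trans hB1)// (le_trans (ler_norm _))// lerDl.
  by rewrite fh ler_norml => /andP[h1 _]; lra.
have ft0 : 0 < f t x by rewrite (lt_le_trans _ fc) ?divr_gt0.
have ftE : f t = cst c + t *: h t by apply/funext => y; rewrite fh.
have dft : is_diff x (f t) (t *: ('d (h t) x : E -> R)).
  rewrite ftE; have dht := differentiableP (dh t x).
  by apply: is_diff_eq; rewrite add0r.
have dln : is_diff (f t x) (@ln R) ( *:%R^~ ((f t x)^-1)).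
  have dl := is_derive1_ln ft0.
  apply: DiffDef; first by apply/derivable1_diffP; exact: ex_derive.
  by rewrite deriv1E ?derive1E ?derive_val.
have dd := is_diff_comp dft dln.
have ddiff := @ex_diff _ _ _ _ _ _ _ dd; split=> //.
rewrite deriveE// (@diff_val _ _ _ _ _ _ _ dd) /=.
rewrite -[(_ *: _) v]/(t * 'd (h t) x v) -deriveE//.
rewrite normrM normrM (gtr0_norm t0) [leRHS]mulrC -mulrA ler_wpM2l ?(ltW t0)//.
rewrite mulrC ler_pM//.
  rewrite normrV ?unitfE ?gt_eqF// gtr0_norm// -[leRHS]invrK invf_div.
  by rewrite lef_pV2 ?posrE ?divr_gt0.
exact: le_trans hB2 (ler_norm _).
Unshelve. all: by end_near. Qed.

End Perturbation.

(** * Smoothness of sums and products, and auxiliary limits *)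

Section SmoothAlgebra.
Context {R : realType} {E : normedModType R}.
Implicit Types f g : E -> R.

Lemma smooth_cst (c : R) : smooth (fun _ : E => c).
Proof.
move=> k; elim: k c => [|k IH] c /=; first by move=> x; exact: cvg_cst.
split=> [x|v]; first exact: differentiable_cst.
by under eq_fun do rewrite derive_cst; exact: IH.
Qed.

(** Stated order by order because the induction in [smoothM] knows the two summands of the product
    rule only up to order [k]. *)
Lemma of_class_CD k f g : of_class_C k f -> of_class_C k g ->
  of_class_C k (fun x => f x + g x).
Proof.
elim: k f g => [|k IH] f g /=.
  by move=> cf cg x; apply: continuousD; [exact: cf|exact: cg].
move=> [df Df] [dg Dg]; split=> [x|v]; first exact: differentiableD.
rewrite (_ : (fun x => _) = (fun x => 'D_v f x + 'D_v g x)); first exact: IH.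
by apply/funext => x; apply: deriveD; exact: diff_derivable.
Qed.

Lemma smoothD f g : smooth f -> smooth g -> smooth (fun x => f x + g x).
Proof. by move=> fs gs k; exact: of_class_CD. Qed.

Lemma smoothM f g : smooth f -> smooth g -> smooth (fun x => f x * g x).
Proof.
move=> fs gs k; elim: k f g fs gs => [|k IH] f g fs gs /=.
  move=> x; apply: continuousM.
    exact: (smooth_continuous fs).
  exact: (smooth_continuous gs).
have df := smooth_differentiable fs; have dg := smooth_differentiable gs.
split=> [x|v]; first exact: differentiableM.
rewrite (_ : (fun x => _) = (fun x => f x * 'D_v g x + g x * 'D_v f x)).
  by apply: of_class_CD; apply: IH => //; exact: smooth_derive.
by apply/funext => x; rewrite -deriveM//; exact: diff_derivable.
Qed.

Lemma smooth_sum (I : Type) (s : seq I) (f : I -> E -> R) :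
  (forall i, smooth (f i)) -> smooth (fun x => \sum_(i <- s) f i x).
Proof.
move=> fs; elim: s => [|i s IH].
  by under eq_fun do rewrite big_nil; exact: smooth_cst.
by under eq_fun do rewrite big_cons; exact: smoothD.
Qed.

End SmoothAlgebra.

Lemma perturbation_smooth {R : realType} {k : nat} (r : R) (v : 'cV[R]_k)
    (c : R) (g : 'cV[R]_k -> R) :
  smooth g -> perturbation r v (fun t x => c + t * g x) c.
Proof.
move=> gs.
have [B hB] := continuous_bounded_ball _ r (smooth_continuous gs).
have [C hC] :=
  continuous_bounded_ball _ r (smooth_continuous (smooth_derive gs v)).
exists (fun=> g), (Num.max B C); split => // [_ x|_ x _ xr].
  exact: smooth_differentiable.
by rewrite !le_max hB// hC// orbT.
Qed.

Lemma bounded_coord {R : realType} {T : Type} {m n : nat} (P : T -> Prop)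
    (f : T -> 'M[R]_(m, n)) :
  (forall i j, exists C, forall x, P x -> `|f x i j| <= C) ->
  exists2 C, 0 <= C & forall x, P x -> `|f x| <= C.
Proof.
move=> h.
have [|C C0 hC] := uniform_bound P
    (fun (ij : 'I_m * 'I_n) x => `|f x ij.1 ij.2|).
  by move=> ij; exact: h.
by exists C => // x Px; apply/mx_norm_leP => // i j; exact: (hC (i, j)).
Qed.

(** For 0 < nu <= 1 the square is positive and at most nu; this permits the substitution t =
    nu^2. *)
Lemma near_right_sqr {R : realType} (P : R -> Prop) :
  (\forall t \near 0^'+, P t) -> \forall nu \near 0^'+, P (nu ^+ 2).
Proof.
move=> [e /= e0 eP]; near=> nu.
have nu0 : 0 < nu by near: nu; exact: nbhs_right_gt.
have nu1 : nu <= 1 by near: nu; apply: nbhs_right_le.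
have nue : nu < e by near: nu; apply: nbhs_right_lt.
apply: eP => /=; last exact: exprn_gt0.
rewrite sub0r normrN ger0_norm ?sqr_ge0// (le_lt_trans _ nue)//.
by rewrite expr2 ler_piMl// ltW.
Unshelve. all: by end_near. Qed.

(** * Size of the Fixman force *)

Section Convergence.
Context {R : realType} {d n : nat}.
Variables (M : 'M[R]_d) (Mz : 'M[R]_n) (xi : 'cV[R]_d -> 'cV[R]_n).
Hypothesis xi_smooth : smooth xi.

Lemma smooth_nabla i j : smooth (fun q => nabla xi q i j).
Proof.
under eq_fun do rewrite mxE.
exact/smooth_derive/smooth_coord.
Qed.

(** With t = nu^2 the determinant of [M_nu] is a perturbation of det M > 0, so each partial
    derivative of its logarithm is O(t) on the ball. *)
Lemma fixman_force_O2 (beta r : R) (fixman : bool) : sym_posdef M ->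
  exists C, \forall nu \near 0^'+, forall q, `|q| <= r ->
    `|fixman_force M Mz xi beta fixman nu q| <= C * nu ^+ 2.
Proof.
move=> M_spd; case: fixman; last first.
  by exists 0; near=> nu => q _; rewrite mul0r normr0.
pose F t q := M + t *: (nabla xi q *m Mz *m (nabla xi q)^T).
have pF v : perturbation r v (fun t q => \det (F t q)) (\det M).
  apply: perturbation_det => i j; under eq_fun do under eq_fun do rewrite 2!mxE.
  apply: perturbation_smooth; under eq_fun do rewrite mxE.
  apply: smooth_sum => k; apply: smoothM.
    under eq_fun do rewrite mxE; apply: smooth_sum => l.
    by apply: smoothM; [exact: smooth_nabla|exact: smooth_cst].
  by under eq_fun do rewrite mxE; exact: smooth_nabla.
have /choice[C hC] (j : 'I_d) :=
  perturbation_ln _ _ (sym_posdef_det_gt0 _ M_spd) (pF (delta_mx j 0)).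
exists (`|(2 * beta)^-1| * \sum_j `|C j|).
(* Finitely many coordinates share one neighborhood of 0, after which t becomes nu^2. *)
have /near_right_sqr : \forall t \near 0^'+, forall j q, `|q| <= r ->
    differentiable (fun x => ln (\det (F t x))) q /\
    `|'D_(delta_mx j 0) (fun x => ln (\det (F t x))) q| <= C j * t.
  by near=> t => j; move: j; near: t; exact: filter_forall.
apply: filterS => nu hnu q qr; apply/mx_norm_leP => [|j i].
  by rewrite mulr_ge0 ?sqr_ge0// mulr_ge0 ?sumr_ge0.
have [dln Dln] := hnu j q qr.
rewrite mxE (_ : V_fix _ _ _ _ _ =
  (2 * beta)^-1 *: (fun x => ln (\det (F (nu ^+ 2) x))) :> (_ -> _))//.
rewrite deriveZ; last exact: diff_derivable.
rewrite normrZ -mulrA ler_wpM2l// (le_trans Dln)// ler_wpM2r ?sqr_ge0//.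
by rewrite (bigD1 j)//= (le_trans (ler_norm _))// lerDl sumr_ge0.
Unshelve. all: by end_near. Qed.

(** * Elimination of the Lagrange multipliers *)

Section Multipliers.
Variables (dt : R) (gp : 'cV[R]_d -> 'cV[R]_d) (gz : 'cV[R]_d -> 'cV[R]_n).
Hypotheses (Mz_unit : Mz \in unitmx) (dt_gt0 : 0 < dt).

(** [Mz] applied to the gap between the instantaneous velocity of xi at (y, p) and its mean velocity
    over the step. At either end of the step, nu times it is the auxiliary momentum there minus the
    half-step one. *)
Definition multiplier_defect (q q' y p : 'cV[R]_d) : 'cV[R]_n :=
  Mz *m ((nabla xi y)^T *m invmx M *m p - dt^-1 *: (xi q' - xi q)).

(* Both constraints determine the half-step auxiliary momentum, so that the
   multipliers can be solved for. *)
Lemma constrained_stepE nu s l s' : 0 < nu ->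
  on_constraint M Mz xi nu s ->
  constrained_step M Mz xi dt gp gz nu s l s' ->
  let q := pos s in let q' := pos s' in
  let force x := gp x + nu *: (nabla xi x *m gz x) in
  let defect y p := nu ^+ 2 *: (nabla xi y *m multiplier_defect q q' y p) in
  let ph := mom s - (dt / 2) *: force q + defect q (mom s) in
  q' = q + dt *: (invmx M *m ph) /\
  mom s' = ph - (dt / 2) *: force q' - defect q' (mom s').
Proof.
move=> nu0 [xi1 pz1] [q'E [z'E [p'E [pz'E [xi2 pz2]]]]] q q' force defect ph.
have nuN0 : nu != 0 by rewrite gt_eqF.
have dtN0 : dt != 0 by rewrite gt_eqF.
pose pzh := auxmom s - (dt / 2) *: gz (pos s) + nu^-1 *: l.1.
(* Solves a velocity constraint for the auxiliary momentum. *)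
have pzE (w y : 'cV[R]_n) : w = nu^-1 *: (invmx Mz *m y) -> y = nu *: (Mz *m w).
  by move=> ->; rewrite -scalemxAr mulKVmx// scalerA divff// scale1r.
have nu2 (w : 'cV[R]_n) : nu ^+ 2 *: w = nu *: (nu *: w) by rewrite scalerA.
(* The position constraint at both ends turns the z-update into a formula for the half-step
   auxiliary momentum. *)
have pzhE : pzh = nu *: (Mz *m (dt^-1 *: (xi q' - xi q))).
  apply: pzE; rewrite xi1 xi2 z'E -/pzh; move: (invmx Mz *m pzh) => w.
  by apply/colP => i; rewrite !mxE; field; rewrite nuN0.
have defectE y p : nu *: multiplier_defect q q' y p =
    nu *: (Mz *m ((nabla xi y)^T *m invmx M *m p)) - pzh.
  by rewrite pzhE -scalerBr -mulmxBr.
have l1E : l.1 =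
    (dt / 2 * nu) *: gz q - nu ^+ 2 *: multiplier_defect q q' q (mom s).
  rewrite nu2 defectE -(pzE _ _ pz1) /pzh.
  by apply/colP => i; rewrite !mxE; field.
have l2E : l.2 =
    (dt / 2 * nu) *: gz q' + nu ^+ 2 *: multiplier_defect q q' q' (mom s').
  rewrite nu2 defectE -(pzE _ _ pz2) pz'E -/pzh.
  by apply/colP => i; rewrite !mxE; field.
(* The leading part of the multiplier joins [gp] to form [force]; the rest is [defect]. *)
have phE : ph = mom s - (dt / 2) *: gp q - nabla xi q *m l.1.
  rewrite l1E mulmxBr -!scalemxAr /ph /force /defect.
  move: (_ *m gz q) (_ *m multiplier_defect _ _ _ _) => a b.
  by apply/colP => i; rewrite !mxE; field.
split; first by rewrite phE.
rewrite [LHS]p'E -phE l2E mulmxDr -!scalemxAr /force /defect.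
move: (_ *m gz q') (_ *m multiplier_defect _ _ _ _) (ph) => a b c.
by apply/colP => i; rewrite !mxE; field.
Qed.
End Multipliers.

(** The expression is free of nu and built from xi and its gradient, both bounded on the ball; each
    matrix product costs a factor equal to its inner dimension. *)
Lemma multiplier_defect_bounded (dt r : R) :
  exists C, forall q q' y p, `|q| <= r -> `|q'| <= r -> `|y| <= r ->
    `|p| <= r -> `|nabla xi y *m multiplier_defect dt q q' y p| <= C.
Proof.
have [i j|G G0 hG] := bounded_coord (fun x => `|x| <= r) (nabla xi).
  exact/continuous_bounded_ball/smooth_continuous/smooth_nabla.
have [i j|X X0 hX] := bounded_coord (fun x => `|x| <= r) xi.
  exact/continuous_bounded_ball/smooth_continuous/smooth_coord.
exists (n%:R * G * (n%:R * `|Mz| *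
  (d%:R * (d%:R * G * `|invmx M|) * r + `|dt^-1| * (X + X)))).
move=> q q' y p qr q'r yr pr; have r0 : 0 <= r := le_trans (normr_ge0 _) qr.
have mul_le (a b c : nat) (A : 'M[R]_(a, b)) (B : 'M[R]_(b, c)) u v :
    `|A| <= u -> `|B| <= v -> `|A *m B| <= b%:R * u * v.
  move=> Au Bv; rewrite (le_trans (normr_mulmx_le _ _))// -!mulrA ler_wpM2l//.
  by rewrite ler_pM.
apply: (mul_le _ _ _ _ _ _ _ (hG y yr)).
apply: (mul_le) => //; rewrite (le_trans (ler_normB _ _))// lerD//.
  by apply: (mul_le) => //; apply: (mul_le) => //; rewrite normr_trmx hG.
rewrite normrZ ler_wpM2l// (le_trans (ler_normB _ _))// lerD// hX//.
Qed.

(** * Comparison with the Verlet step *)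

(** Common to both integrators: without multipliers, the step is a Verlet step for the effective
    force gp + nu nabla xi gz with two corrections of size O(nu^2), so it suffices that this force
    be O(nu^2)-close to grad V on balls. *)
Lemma constrained_step_O2 (dt : R) (V : 'cV[R]_d -> R)
    (gp : R -> 'cV[R]_d -> 'cV[R]_d) (gz : R -> 'cV[R]_d -> 'cV[R]_n) :
  M \in unitmx -> Mz \in unitmx -> 0 < dt -> smooth V ->
  (forall r, exists C, \forall nu \near 0^'+, forall q, `|q| <= r ->
    `|gp nu q + nu *: (nabla xi q *m gz nu q) - grad V q| <= C * nu ^+ 2) ->
  converges_to_verlet_O2 M Mz xi dt V
    (fun nu => constrained_step M Mz xi dt (gp nu) (gz nu) nu).
Proof.
move=> M_unit Mz_unit dt0 V_smooth force_O2 q p N _ [r0 [_ hN]] _.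
pose qV := (verlet M dt V q p).1.
(* One ball for the initial data, the Verlet position and all of [N]; boundedness of [N] gives a
   bound by any number strictly above [r0], hence the 1. *)
pose r := Num.max (Num.max `|q| `|p|) (Num.max `|qV| (r0 + 1)).
have qr : `|q| <= r by rewrite !le_max lexx.
have pr : `|p| <= r by rewrite !le_max lexx orbT.
have qVr : `|qV| <= r by rewrite !le_max lexx !orbT.
have Nr y : N y -> `|y.1| <= r /\ `|y.2| <= r.
  move=> Ny; have : `|y| <= r.
    by rewrite (le_trans (hN (r0 + 1) _ _ Ny)) ?ltrDl// !le_max lexx !orbT.
  by rewrite prod_normE ge_max => /andP.
have [A hA] := multiplier_defect_bounded dt r.
have [C hC] := force_O2 r.
(* Writing the Lipschitz bounds as quotients gives a single constant for all coordinates; the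
   diagonal x = y is treated apart. *)
have [|L L0 hL] := uniform_bound
    (fun z : 'cV[R]_d * 'cV[R]_d => `|z.1| <= r /\ `|z.2| <= r)
    (fun (j : 'I_d) z => `|grad V z.1 j 0 - grad V z.2 j 0| / `|z.1 - z.2|).
  move=> j; have [L hL] := smooth_lipschitz_ball _ r
    (smooth_derive V_smooth (delta_mx j 0)).
  exists `|L| => -[x y] [/= xr yr]; rewrite !mxE.
  have [->|xy] := eqVneq x y; first by rewrite !subrr normr0 mul0r.
  rewrite ler_pdivrMr ?normr_gt0 ?subr_eq0// (le_trans (hL _ _ xr yr))//.
  by rewrite ler_wpM2r// ler_norm.
have {}hL x y : `|x| <= r -> `|y| <= r ->
    `|grad V x - grad V y| <= L * `|x - y|.
  move=> xr yr; have [->|xy] := eqVneq x y.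
    by rewrite !subrr !normr0 mulr0.
  apply/mx_norm_leP => [|j i]; first by rewrite mulr_ge0.
  rewrite ord1 3!mxE -ler_pdivrMr ?normr_gt0 ?subr_eq0//.
  by have := hL j (x, y) (conj xr yr); rewrite !mxE.
pose h := dt / 2; have h0 : 0 <= h by rewrite divr_ge0// ltW.
(* [C1] is for the half-step momentum: force error plus defect. [C2] propagates it to the position.
   The final momentum adds a second [C1] and the change of grad V between the two new positions. *)
pose C1 := h * C + A.
pose C2 := dt * (d%:R * `|invmx M| * C1).
exists (Num.max C2 (C1 + C1 + h * (L * C2))).
near=> nu => s l s' [sq [sp s_on]] step /Nr[q'r p'r].
rewrite /= in q'r p'r.
have nu0 : 0 < nu by near: nu; exact: nbhs_right_gt.
have nu2 := sqr_ge0 nu.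
have forceC x : `|x| <= r ->
    `|gp nu x + nu *: (nabla xi x *m gz nu x) - grad V x|
    <= C * nu ^+ 2.
  by move: x; near: nu.
pose q' := pos s'; pose p' := mom s'; pose phV := p - h *: grad V q.
pose force x := gp nu x + nu *: (nabla xi x *m gz nu x).
pose defect y z :=
  nu ^+ 2 *: (nabla xi y *m multiplier_defect dt q q' y z).
pose ph := p - h *: force q + defect q p.
have [q'E p'E] : q' = q + dt *: (invmx M *m ph) /\
    p' = ph - h *: force q' - defect q' p'.
  have := constrained_stepE _ _ _ Mz_unit dt0 _ _ _ _ nu0 s_on step.
  by rewrite sq sp.
have -> : (verlet M dt V q p).2 = phV - h *: grad V qV by [].
rewrite -/qV -/q' -/p'.
have defectA y z : `|y| <= r -> `|z| <= r -> `|defect y z| <= A * nu ^+ 2.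
  move=> yr zr; rewrite normrZ ger0_norm// mulrC ler_wpM2r//.
  exact: hA.
have dph : `|ph - phV| <= C1 * nu ^+ 2.
  have -> : ph - phV = - (h *: (force q - grad V q)) + defect q p.
    rewrite /ph /phV; move: (defect q p) (force q) (grad V q) => a b c.
    by apply/colP => i; rewrite !mxE /h; field.
  rewrite mulrDl (le_trans (ler_normD _ _))// normrN normrZ (ger0_norm h0).
  by rewrite lerD ?defectA// -mulrA ler_wpM2l// forceC.
have dq : `|q' - qV| <= C2 * nu ^+ 2.
  have -> : q' - qV = dt *: (invmx M *m (ph - phV)).
    by rewrite mulmxBr scalerBr q'E opprD addrACA subrr add0r.
  rewrite normrZ gtr0_norm// -mulrA ler_wpM2l ?(ltW dt0)//.
  by rewrite (le_trans (normr_mulmx_le _ _))// -!mulrA !ler_wpM2l.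
have dp : `|p' - (phV - h *: grad V qV)| <=
    (C1 + C1 + h * (L * C2)) * nu ^+ 2.
  (* The force is first compared with grad V at the same point [q'], then grad V at [q'] with grad V
     at [qV]. *)
  have -> : p' - (phV - h *: grad V qV) = (ph - phV) -
      (h *: (force q' - grad V q') + defect q' p') -
      h *: (grad V q' - grad V qV).
    rewrite [in LHS]p'E; move: (defect q' p') (force q') (ph) (phV).
    move: (grad V q') (grad V qV) => a b c e f g.
    by apply/colP => i; rewrite !mxE /h; field.
  rewrite !mulrDl (le_trans (ler_normB _ _))// lerD//.
    rewrite (le_trans (ler_normB _ _))// lerD//; first by rewrite -mulrDl.
    rewrite (le_trans (ler_normD _ _))// lerD ?defectA//.
    by rewrite normrZ ger0_norm// -mulrA ler_wpM2l// forceC.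
  rewrite normrZ ger0_norm// -(mulrA h) ler_wpM2l// -mulrA.
  rewrite (le_trans (hL q' qV q'r qVr))//.
  by rewrite ler_wpM2l.
split; [apply: le_trans dq _|apply: le_trans dp _];
  by rewrite ler_wpM2r// le_max lexx ?orbT.
Unshelve. all: by end_near. Qed.
End Convergence.

Theorem proposition4p3 (R : realType) (d n : nat)
    (M : 'M[R]_d) (Mz : 'M[R]_n) (beta dt : R)
    (V : 'cV[R]_d -> R) (xi : 'cV[R]_d -> 'cV[R]_n)
    (M_spd : sym_posdef M) (Mz_spd : sym_posdef Mz)
    (beta_gt0 : 0 < beta) (dt_gt0 : 0 < dt)
    (V_smooth : smooth V) (xi_smooth : smooth xi) :
  (forall fixman : bool,
     converges_to_verlet_O2 M Mz xi dt V
       (integratorA M Mz xi beta dt fixman V)) /\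
  (forall U : 'cV[R]_d -> 'cV[R]_n -> R,
     smooth (fun x : 'cV[R]_d * 'cV[R]_n => U x.1 x.2) ->
     (forall q : 'cV[R]_d, V q = U q (xi q)) ->
     forall fixman : bool,
       converges_to_verlet_O2 M Mz xi dt V
         (integratorB M Mz xi beta dt fixman U)).
Proof.
have M_unit := sym_posdef_unitmx M_spd.
have Mz_unit := sym_posdef_unitmx Mz_spd.
split=> [fixman|U U_smooth VU fixman].
  (* For (A) the effective force differs from grad V by exactly the Fixman term. *)
  apply: (constrained_step_O2 M Mz xi xi_smooth dt V
    (fun nu x => grad V x + fixman_force M Mz xi beta fixman nu x)
    (fun _ => fun=> 0)) => // r.
  have [C hC] := fixman_force_O2 M Mz xi xi_smooth beta r fixman M_spd.
  exists C; apply: filterS hC => nu hC q /hC.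
  by rewrite mulmx0 scaler0 addr0 addrC addKr.
(* For (B) the factors nu and 1/nu cancel, and the chain rule assembles the two partial gradients of
   [U] into grad V, again leaving the Fixman term. *)
apply: (constrained_step_O2 M Mz xi xi_smooth dt V
  (fun nu x => grad (fun y => U y (xi x)) x +
               fixman_force M Mz xi beta fixman nu x)
  (fun nu x => nu^-1 *: grad (U x) (xi x))) => // r.
have [C hC] := fixman_force_O2 M Mz xi xi_smooth beta r fixman M_spd.
have gradV x : grad V x =
    grad (fun y => U y (xi x)) x + nabla xi x *m grad (U x) (xi x).
  rewrite -(grad_comp_graph _ _ U_smooth xi_smooth).
  by congr (grad _ x); exact/funext.
exists C; near=> nu => q qr.
have nu0 : 0 < nu by near: nu; exact: nbhs_right_gt.
rewrite -scalemxAr scalerA divff ?gt_eqF// scale1r gradV.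
rewrite [X in X - _]addrAC [X in X - _]addrC addrK.
by move: q qr; near: nu.
Unshelve. all: by end_near. Qed.
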